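(* Let $(H_w,H_r)$ be a target pair and let $K$ be an integer with $K\ge\max\{1,N^*\}$. Then $(H_w,H_r)$ is realizable at cap $K$ if and only if it is realizable in the uncapped model.
   Context: An instance consists of a finite set $E$ of items with rational values $a_i\ge 0$, positive integer sizes $d_i$, and integer capacities $0\le R<D$, with $d_i\le D$ for every item. Write $G(S)=\sum_{i\in S}a_i$ and $d(S)=\sum_{i\in S}d_i$. For $\alpha\in\{w,r\}$ let $U^\alpha(n)$ be the maximum of $G(S)$ over $n$-element admissible sets $S\subseteq E$, with value $-\infty$ if there is none; $U^\alpha(0)=0$. In the uncapped model $S$ is admissible if $d(S)\le D$ (for $\alpha=w$) or $d(S)\le R$ (for $\alpha=r$). At an integer cap $K\ge1$ one requires in addition $|S|\le K$ for $\alpha=w$ and $|S|\le K-1$ for $\alpha=r$. The terminal count is $b_\alpha=\min\operatorname{arg\,max}_n U^\alpha(n)$. The hull is the sequence on $\{0,\dots,b_\alpha\}$ obtained by evaluating at integers the upper concave hull of the points $(n,U^\alpha(n))$, $0\le n\le b_\alpha$. A target pair $(H_w,H_r)$ consists of strictly increasing concave rational sequences $H_\alpha$ on $\{0,\dots,b_\alpha\}$ with $H_\alpha(0)=0$ (the zero sequence $(0)$, with $b_\alpha=0$, is allowed). It is realizable in the uncapped model (respectively at cap $K$) if a single instance has terminal counts $b_w,b_r$ and hulls exactly $H_w,H_r$ in that model. $\mathcal V_\alpha$ is the set of positive counts $n\le b_\alpha$ such that $n=b_\alpha$ or the slopes of $H_\alpha$ immediately before and after $n$ differ, and $N^*=\sum_{n\in\mathcal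 V_w}n+\sum_{m\in\mathcal V_r}m$. *)

(* Defs.v *)
From HB Require Import structures.
From mathcomp Require Import all_boot all_order all_algebra.
From mathcomp Require Import constructive_ereal.

Set Implicit Arguments.
Unset Strict Implicit.
Unset Printing Implicit Defensive.

Import Order.TTheory GRing.Theory Num.Theory.

Local Open Scope ring_scope.

Record instance := Instance {
  item : finType;
  value : item -> rat;
  weight : item -> nat;
  capR : nat;
  capD : nat;
  value_ge0 : forall i, 0 <= value i;
  weight_gt0 : forall i, (0 < weight i)%N;
  capR_lt_capD : (capR < capD)%N;
  weight_le_capD : forall i, (weight i <= capD)%N
}.

Definition total_value (I : instance) (S : {set item I}) : rat :=
  \sum_(i in S) value i.

Definition total_weight (I : instance) (S : {set item I}) : nat :=
  (\sum_(i in S) weight i)%N.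

Variant side := side_w | side_r.

Definition capacity (I : instance) (s : side) : nat :=
  if s is side_w then capD I else capR I.

(* The bound on #|S| imposed at cap K; only used with 1 <= K, so that K.-1 is
   the genuine K - 1. *)
Definition count_bound (K : nat) (s : side) : nat :=
  if s is side_w then K else K.-1.

(* A model is an [option nat]: [None] is the uncapped model, [Some K] is the
   model at cap K. *)
Definition admissible (I : instance) (model : option nat) (s : side)
    (S : {set item I}) : bool :=
  (total_weight S <= capacity I s)%N &&
  (if model is Some K then (#|S| <= count_bound K s)%N else true).

(* The maximum is -oo when there is no admissible set of cardinality n. *)
Definition U (I : instance) (model : option nat) (s : side) (n : nat) :
    \bar rat :=
  \big[Order.max/-oo%E]_(S : {set item I} | (#|S| == n) && admissible model s S)
    (total_value S)%:E.

(* The convention U(0) = 0 need not be imposed. *)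
Lemma U0 (I : instance) (model : option nat) (s : side) : U I model s 0 = 0%E.
Proof.
rewrite /U (big_pred1 set0) => [|S].
  by rewrite /total_value big_set0.
rewrite /= cards_eq0 andb_idr // => /eqP->.
rewrite /admissible /total_weight big_set0 leq0n cards0 /=.
by case: model.
Qed.

(* b is the least element of argmax_n u n. *)
Definition is_terminal_count (u : nat -> \bar rat) (b : nat) : Prop :=
  (forall m, (u m <= u b)%E) /\
  (forall n, (forall m, (u m <= u n)%E) -> (b <= n)%N).

(* The weights l form a convex combination of the abscissae 0, ..., b with
   barycentre x. *)
Definition convex_weights (b : nat) (x : rat) (l : 'I_b.+1 -> rat) : Prop :=
  [/\ forall n, 0 <= l n, \sum_n l n = 1 & \sum_n l n * n%:R = x].

(* y is the height at x of the upper boundary of the convex hull of the points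
   (n, u n), 0 <= n <= b.  As 0 * -oo = 0 and r * -oo = -oo for 0 < r, points
   of height -oo never contribute. *)
Definition is_upper_hull (u : nat -> \bar rat) (b : nat) (x y : rat) : Prop :=
  (exists2 l, convex_weights x l &
     (\sum_(n < b.+1) (l n)%:E * u n)%E = y%:E) /\
  (forall l, convex_weights x l ->
     (\sum_(n < b.+1) (l n)%:E * u n <= y%:E)%E).

(* A sequence on {0, ..., b} is given by a function on nat whose values beyond
   b are never used. *)
Definition is_hull_sequence (u : nat -> \bar rat) (b : nat) (H : nat -> rat) :
    Prop :=
  forall k, (k <= b)%N -> is_upper_hull u b k%:R (H k).

Definition target (b : nat) (H : nat -> rat) : Prop :=
  [/\ H 0%N = 0,
      forall n, (n < b)%N -> H n < H n.+1
    & forall n, (n.+1 < b)%N -> H n.+2 - H n.+1 <= H n.+1 - H n].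

Definition realizable (model : option nat)
    (bw : nat) (Hw : nat -> rat) (br : nat) (Hr : nat -> rat) : Prop :=
  exists I : instance,
    [/\ is_terminal_count (U I model side_w) bw,
        is_hull_sequence (U I model side_w) bw Hw,
        is_terminal_count (U I model side_r) br
      & is_hull_sequence (U I model side_r) br Hr].

Definition realizable_uncapped := realizable None.

Definition realizable_at_cap (K : nat) := realizable (Some K).

(* Membership in the set V of the positive counts n <= b. *)
Definition breakpoint (b : nat) (H : nat -> rat) (n : nat) : bool :=
  (n == b) || (H n - H n.-1 != H n.+1 - H n).

Definition breakpoint_sum (b : nat) (H : nat -> rat) : nat :=
  (\sum_(1 <= n < b.+1 | breakpoint b H n) n)%N.

Definition Nstar (bw : nat) (Hw : nat -> rat) (br : nat) (Hr : nat -> rat) :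
    nat :=
  (breakpoint_sum bw Hw + breakpoint_sum br Hr)%N.

(* Main.v *)
Require Import Defs.
From mathcomp Require Import all_boot all_order all_algebra.
From mathcomp Require Import constructive_ereal ring lra.

Set Implicit Arguments.
Unset Strict Implicit.
Unset Printing Implicit Defensive.

Import Order.TTheory GRing.Theory Num.Theory.

Local Open Scope ring_scope.

(** The terminal count and the hull of a sequence u with u 0 = 0 are b and H
    exactly when u stays below H, prolonged by the constant H b beyond b, and
    meets H at the breakpoints (terminal_hullP).  For the sequences U this
    becomes a statement about sets: every admissible S has value at most
    H (min #|S| b), and every breakpoint n has an admissible n-element set of
    value H n (realizes, realizesP).

    From this form, passing from the uncapped model to the cap K is a matter of
    counts: the same instance works as soon as the witnesses fit under the cap,
    that is bw <= K and br <= K - 1.  Both follow from bw + br <= N* <= K, since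
    bw > 0 whenever br > 0.

    Conversely, choose one witness for each breakpoint of either side and let E
    be their union, so that #|E| <= N* <= K.  Make all items outside E
    worthless (prune).  A set is then worth what it contains of E, and a subset
    of E respects the cap K, so the bound on the w side survives when the cap is
    lifted.  On the r side the bound can fail only for E itself, when #|E| = K
    and E fits into R (full_pool_value).  If the w witness A for bw is a proper
    subset of E, discarding from E an item outside A loses nothing, because A is
    already worth as much as E; the remaining K - 1 items obey the capped r
    bound.  If A = E then bw = K, which exhausts N*, so br = 0; for K > 1 every
    single item of E is r-admissible at cap K, hence worthless.  For K = 1 the
    cap makes the r side trivial, and in the uncapped instance the same is
    achieved by lowering the capacity R to 0. *)

(** * Targets prolonged by a constant *)

Section Plateau.

Variables (b : nat) (H : nat -> rat).

Definition plateau (n : nat) : rat := H (minn n b).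

Definition slope (n : nat) : rat := plateau n.+1 - plateau n.

Hypothesis tH : target b H.

Lemma plateauE n : (n <= b)%N -> plateau n = H n.
Proof. by move=> nb; rewrite /plateau (minn_idPl nb). Qed.

Lemma plateau_max n : (b <= n)%N -> plateau n = H b.
Proof. by move=> bn; rewrite /plateau (minn_idPr bn). Qed.

Lemma slopeE n : (n < b)%N -> slope n = H n.+1 - H n.
Proof. by move=> nb; rewrite /slope !plateauE // ltnW. Qed.

Lemma slope0 n : (b <= n)%N -> slope n = 0.
Proof. by move=> bn; rewrite /slope !plateau_max ?subrr // (leq_trans bn). Qed.

Lemma slope_gt0 n : (n < b)%N -> 0 < slope n.
Proof. by case: tH => _ inc _ nb; rewrite slopeE // subr_gt0 inc. Qed.

Lemma slope_ge0 n : 0 <= slope n.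
Proof. by have [/slope0->|/slope_gt0/ltW] := leqP b n. Qed.

Lemma slope_noninc m n : (m <= n)%N -> slope n <= slope m.
Proof.
move=> mn; apply: (@homo_leq _ _ (fun x y => y <= x)) mn => //.
  by move=> y x z xy yz; apply: le_trans yz xy.
move=> i; have [/slope0->|ib] := leqP b i.+1; first exact: slope_ge0.
by case: tH => _ _ conc; rewrite !slopeE ?conc // ltnW.
Qed.

Lemma plateauB m n : (m <= n)%N ->
  plateau n - plateau m = \sum_(m <= i < n) slope i.
Proof. by move=> mn; rewrite telescope_sumr. Qed.

Lemma plateau_homo m n : (m <= n)%N -> plateau m <= plateau n.
Proof.
by move=> mn; rewrite -subr_ge0 plateauB // sumr_ge0 // => i _; apply: slope_ge0.
Qed.

Lemma plateau0 : plateau 0 = 0.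
Proof. by case: tH; rewrite /plateau min0n. Qed.

Lemma target_gt0 : (0 < b)%N -> 0 < H b.
Proof.
move=> b0; rewrite -(plateauE (leqnn b)); apply: (@lt_le_trans _ _ (plateau 1)).
  by have := slope_gt0 b0; rewrite /slope plateau0 subr0.
exact: plateau_homo.
Qed.

Lemma plateau_lt n : (n < b)%N -> plateau n < H b.
Proof.
move=> nb; apply: (@lt_le_trans _ _ (plateau n.+1)).
  by rewrite -subr_gt0 slope_gt0.
by rewrite -(plateauE (leqnn b)) plateau_homo.
Qed.

(** Concavity: a line through the graph whose slope lies between the two
    one-sided slopes at k stays above the graph.  At k = 0 there is no slope on
    the left, and any c >= slope 0 will do. *)
Lemma supporting_line k c n : slope k <= c -> ((0 < k)%N -> c <= slope k.-1) ->
  plateau n <= plateau k + c * (n%:R - k%:R).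
Proof.
move=> kc ck; rewrite -lerBlDl; have [kn|/ltnW nk] := leqP k n.
  rewrite plateauB // -natrB // mulr_natr -sumr_const_nat.
  by apply: ler_sum_nat => i /andP[ki _]; apply: le_trans (slope_noninc ki) kc.
rewrite -lerN2 -mulrN !opprB plateauB // -natrB // mulr_natr -sumr_const_nat.
apply: ler_sum_nat => i /andP[_ ik]; have k0 : (0 < k)%N by case: (k) ik.
by apply: le_trans (ck k0) (slope_noninc _); rewrite -ltnS prednK.
Qed.

(** The terminal count is a breakpoint by decree in the definition of V; on the
    plateau it is one for the same reason as the others, as the slope drops
    there from a positive value to 0. *)
Lemma slope_breakpoint k : (0 < k <= b)%N ->
  breakpoint b H k = (slope k < slope k.-1).
Proof.
case: k => // k /= kb; rewrite /breakpoint /=.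
case: (k.+1 =P b) => [kb1|/eqP kNb] /=.
  by rewrite slope0 -?kb1 // slope_gt0 -?kb1.
have kb' : (k.+1 < b)%N by rewrite ltn_neqAle kNb.
by rewrite -!slopeE // lt_neqAle slope_noninc // andbT eq_sym.
Qed.

(** Between two distinct one-sided slopes there is room for a line that touches
    the graph at k only; the mean of the two slopes gives one. *)
Lemma strict_supporting_line k : (0 < k <= b)%N -> breakpoint b H k ->
  exists c, forall n, n != k -> plateau n < plateau k + c * (n%:R - k%:R).
Proof.
move=> kb; rewrite slope_breakpoint // => sk.
exists ((slope k + slope k.-1) / 2) => n; rewrite neq_ltn => /orP[nk|kn].
  apply: le_lt_trans (supporting_line n (ltW sk) (fun=> lexx _)) _.
  by rewrite ltrD2l ltr_nM2r ?subr_lt0 ?ltr_nat //; lra.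
apply: le_lt_trans (supporting_line n (lexx _) (fun=> ltW sk)) _.
by rewrite ltrD2l ltr_pM2r ?subr_gt0 ?ltr_nat //; lra.
Qed.

Lemma affine_piece p q n : (p <= n <= q)%N -> (q <= b)%N ->
  (forall i, (p < i < q)%N -> ~~ breakpoint b H i) ->
  plateau n - plateau p = slope p * (n%:R - p%:R).
Proof.
move=> /andP[pn nq] qb nobp; rewrite plateauB // -natrB // mulr_natr.
rewrite -sumr_const_nat; apply: eq_big_nat => i /andP[pi iln].
elim: i pi iln => [|i IH]; first by rewrite leqn0 => /eqP->.
rewrite leq_eqVlt => /orP[/eqP-> //|pi] iln.
rewrite -IH //; last exact: ltnW.
have iq : (i.+1 < q)%N by apply: leq_trans iln nq.
have := nobp i.+1; rewrite pi iq => /(_ isT).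
rewrite slope_breakpoint; last by rewrite /= (leq_trans (ltnW iq)).
by rewrite -leNgt /= => ge; apply/le_anti; rewrite ge slope_noninc.
Qed.

End Plateau.

(** * Hulls and breakpoints *)

(** An affine function averages to its value at the barycentre. *)
Lemma convex_line b x (l : 'I_b.+1 -> rat) y c : convex_weights x l ->
  \sum_n l n * (y + c * (n%:R - x)) = y.
Proof.
case=> _ l1 lx; rewrite (eq_bigr (fun n => l n * (y - c * x) + c * (l n * n%:R))).
  by rewrite big_split -mulr_suml -mulr_sumr l1 lx /=; ring.
by move=> n _; ring.
Qed.

Lemma convex_ereal_le b x (l : 'I_b.+1 -> rat) (u : nat -> \bar rat) (h : nat -> rat) :
  convex_weights x l -> (forall n : 'I_b.+1, (u n <= (h n)%:E)%E) ->
  (\sum_(n < b.+1) (l n)%:E * u n <= (\sum_(n < b.+1) l n * h n)%:E)%E.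
Proof.
case=> l0 _ _ uh; rewrite -sumEFin; apply: lee_sum => n _.
by rewrite EFinM lee_wpmul2l // lee_fin.
Qed.

(** Test the hull at n against the weights concentrated at n. *)
Lemma hull_above u b H : is_hull_sequence u b H ->
  forall n, (n <= b)%N -> (u n <= (H n)%:E)%E.
Proof.
move=> hull n nb; pose i : 'I_b.+1 := Ordinal (n:=b.+1) (m:=n) nb.
have [_ /(_ (fun j => (j == i)%:R))] := hull n nb.
rewrite (bigD1 i) //= eqxx mul1e big1 ?adde0; last first.
  by move=> j /negPf->; rewrite mul0e.
apply; split=> [j||]; first exact: ler0n.
  by rewrite (bigD1 i) //= eqxx big1 ?addr0 // => j /negPf->.
by rewrite (bigD1 i) //= eqxx big1 ?addr0 ?mul1r // => j /negPf->; rewrite mul0r.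
Qed.

(** A breakpoint is an extreme point of the hull: if u fell short at n, all
    points of u would lie strictly below the line of strict_supporting_line, and
    no convex combination of them could reach H n. *)
Lemma hull_touches u b H : target b H -> is_hull_sequence u b H ->
  forall n, (0 < n <= b)%N -> breakpoint b H n -> ((H n)%:E <= u n)%E.
Proof.
move=> tH hull n nb bp; rewrite leNgt; apply/negP => lt_un.
have [_ nb'] := andP nb.
(* u n may be -oo, but a rational number below H n still bounds it. *)
have [h uh hH] : exists2 h, (u n <= h%:E)%E & h < H n.
  case: (u n) lt_un => [r|//|_]; first by rewrite lte_fin; exists r.
  by exists (H n - 1); rewrite ?leNye // ltrBlDr ltrDl.
have [[l lP sum_l] _] := hull n nb'.
have [c cP] := strict_supporting_line tH nb bp.
pose h' i := if i == n then h else H i.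
have gap (i : 'I_b.+1) : h' i < H n + c * (i%:R - n%:R).
  rewrite /h'; case: eqP => [->|/eqP /cP]; first by rewrite subrr mulr0 addr0.
  by rewrite !plateauE // -ltnS.
have : H n <= \sum_(i < b.+1) l i * h' i.
  rewrite -lee_fin -sum_l; apply: convex_ereal_le lP _ => i.
  by rewrite /h'; case: eqP => [->//|_]; apply: hull_above hull _ _; rewrite -ltnS.
apply/negP; rewrite -ltNge -[ltRHS](convex_line (H n) c lP).
case: lP => l0 l1 _.
have [/eqP li0|[i li]] : \sum_i l i == 0 \/ exists i, l i != 0.
- case: (pickP (fun i => l i != 0)) => [i li|l00]; first by right; exists i.
  by left; rewrite big1 // => i _; apply/eqP; rewrite -[_ == _]negbK l00.
- by move: l1; rewrite li0 => /eqP; rewrite eq_sym oner_eq0.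
rewrite [ltLHS](bigD1 i) //= [ltRHS](bigD1 i) //=; apply: ltr_leD.
  by rewrite ltr_pM2l // lt_neqAle eq_sym li l0.
by apply: ler_sum => j _; rewrite ler_wpM2l // ltW.
Qed.

(** The point at parameter t of the chord from p to q, allowing p = q. *)
Definition chord_weights (b p q : nat) (t : rat) (n : 'I_b.+1) : rat :=
  (1 - t) * (n == p :> nat)%:R + t * (n == q :> nat)%:R.

Lemma chord_weights_sum b p q t (f : nat -> rat) : (p <= b)%N -> (q <= b)%N ->
  \sum_(n < b.+1) chord_weights p q t n * f n = (1 - t) * f p + t * f q.
Proof.
move=> pb qb; have pick_node i : (i <= b)%N ->
    \sum_(n < b.+1) (n == i :> nat)%:R * f n = f i.
  rewrite -ltnS => ib; rewrite (bigD1 (Ordinal ib)) //= eqxx mul1r big1 ?addr0 //.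
  by move=> j; rewrite -val_eqE /= => /negPf->; rewrite mul0r.
rewrite -(pick_node p pb) -(pick_node q qb) !mulr_sumr -big_split /=.
by apply: eq_bigr => n _; rewrite /chord_weights; ring.
Qed.

(** The upper bound is Jensen's inequality.  It is attained because H is affine
    between consecutive nodes, the nodes being 0 and the breakpoints, so that k
    lies on the chord of the two nodes around it. *)
Lemma hull_of_touching u b H : target b H -> u 0%N = 0%E ->
  (forall n, (n <= b)%N -> (u n <= (H n)%:E)%E) ->
  (forall n, (0 < n <= b)%N -> breakpoint b H n -> ((H n)%:E <= u n)%E) ->
  is_hull_sequence u b H.
Proof.
move=> tH u0 uH Hu k kb; split=> [|l lP]; last first.
  apply: le_trans (convex_ereal_le (h := H) lP _) _ => [n|].
    by apply: uH; rewrite -ltnS.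
  rewrite lee_fin -[leRHS](convex_line _ (slope b H k) lP).
  case: lP => l0 _ _; apply: ler_sum => n _; apply: ler_wpM2l => //.
  have nb : (n <= b)%N by rewrite -ltnS.
  rewrite -(plateauE H nb) -(plateauE H kb) supporting_line // => k0.
  by rewrite slope_noninc // leq_pred.
have touch n : (n <= b)%N -> (n == 0)%N || breakpoint b H n -> u n = (H n)%:E.
  have [-> _ _|n0 nb bp] := posnP n; first by case: tH => ->.
  by apply/le_anti; rewrite uH // Hu ?n0.
have [p /andP[pk nodep] pmax] :
    exists2 p, (p <= k)%N && ((p == 0)%N || breakpoint b H p)
      & forall i, (p < i <= k)%N -> ~~ breakpoint b H i.
  have ex : exists p, (p <= k)%N && ((p == 0)%N || breakpoint b H p) by exists 0%N.
  case: (ex_maxnP ex (m := k)) => [i /andP[] //|p pP pmax]; exists p => // i.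
  case/andP=> pi ik; apply: contraL pi => bp; rewrite -leqNgt; apply: pmax.
  by rewrite ik bp orbT.
have [q /and3P[kq qb bpq] qmin] :
    exists2 q, [&& (k <= q)%N, (q <= b)%N & breakpoint b H q]
      & forall i, (k <= i < q)%N -> ~~ breakpoint b H i.
  have ex : exists q, [&& (k <= q)%N, (q <= b)%N & breakpoint b H q].
    by exists b; rewrite kb leqnn /breakpoint eqxx.
  case: (ex_minnP ex) => q qP qmin; exists q => // i /andP[ki iq].
  apply: contraL (iq) => bp; rewrite -leqNgt; apply: qmin.
  by rewrite ki bp andbT ltnW // (leq_trans iq); case/and3P: qP.
have nobp i : (p < i < q)%N -> ~~ breakpoint b H i.
  case/andP=> pi iq; have [ik|ki] := leqP i k; first by rewrite pmax ?pi.
  by rewrite qmin // ltnW.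
have pb := leq_trans pk kb.
(* If p = q then t = 0 / 0 = 0, and the chord is reduced to its point p. *)
pose t : rat := (k%:R - p%:R) / (q%:R - p%:R).
have [t0 t1] : 0 <= t /\ t <= 1.
  rewrite /t; have [epq|pq] := eqVneq p q.
    by rewrite epq subrr invr0 mulr0 ler01.
  have pq' : (p < q)%N by rewrite ltn_neqAle pq (leq_trans pk).
  have d0 : 0 < q%:R - p%:R :> rat by rewrite subr_gt0 ltr_nat.
  split; first by rewrite divr_ge0 ?(ltW d0) // subr_ge0 ler_nat.
  by rewrite ler_pdivrMr // mul1r lerD2r ler_nat.
have tk : t * (q%:R - p%:R) = k%:R - p%:R.
  rewrite /t; have [epq|pq] := eqVneq p q.
    have -> : k = q by apply/eqP; rewrite eqn_leq kq -epq pk.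
    by rewrite epq subrr mulr0.
  by rewrite divfK // subr_eq0 eqr_nat eq_sym.
exists (chord_weights p q t).
  split=> [n||].
  - by rewrite addr_ge0 // mulr_ge0 // ?subr_ge0 // ler0n.
  - have := chord_weights_sum t (fun=> 1) pb qb.
    under eq_bigr do rewrite mulr1.
    by move->; ring.
  - rewrite (chord_weights_sum t (fun n => n%:R) pb qb).
    by rewrite -[RHS](subrK p%:R) -tk; ring.
have -> : (\sum_(n < b.+1) (chord_weights p q t n)%:E * u n)%E =
    (\sum_(n < b.+1) chord_weights p q t n * H n)%:E.
  rewrite -sumEFin; apply: eq_bigr => n _; rewrite EFinM /chord_weights.
  have [->|_] := eqVneq (n : nat) p; first by rewrite touch.
  have [->|_] := eqVneq (n : nat) q; first by rewrite touch // bpq orbT.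
  by rewrite !mulr0 addr0 !mul0e.
rewrite chord_weights_sum //; congr (_%:E).
have qn0 : (p <= q)%N := leq_trans pk kq.
have := affine_piece tH (n := k) (introT andP (conj pk kq)) qb nobp.
have := affine_piece tH (n := q) (introT andP (conj qn0 (leqnn q))) qb nobp.
rewrite !plateauE // => Eq Ek.
transitivity (H p + t * (H q - H p)); first by ring.
by rewrite Eq mulrCA tk -Ek addrC subrK.
Qed.

(** The plateau puts both constraints in one: u n <= H n for the hull up to b,
    and u n <= H b for the maximality of u b.  Minimality of b costs nothing, as
    H is strictly increasing. *)
Lemma terminal_hullP u b H : target b H -> u 0%N = 0%E ->
  (is_terminal_count u b /\ is_hull_sequence u b H) <->
  (forall n, (u n <= (plateau b H n)%:E)%E) /\
  (forall n, (0 < n <= b)%N -> breakpoint b H n -> ((H n)%:E <= u n)%E).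
Proof.
move=> tH u0; split=> [[[umax _] hull]|[uP Hu]].
  split; last exact: hull_touches.
  have above := hull_above hull.
  move=> n; have [nb|/ltnW bn] := leqP n b; first by rewrite plateauE // above.
  by rewrite plateau_max // (le_trans (umax n)) // above.
have uH n : (n <= b)%N -> (u n <= (H n)%:E)%E by move=> nb; rewrite -(plateauE H nb).
have Hb : ((H b)%:E <= u b)%E.
  case: (posnP b) => [->|b0]; first by rewrite u0; case: tH => ->.
  by apply: Hu; rewrite ?b0 ?leqnn // /breakpoint eqxx.
split; last exact: hull_of_touching.
split=> [m|n nmax].
  apply: le_trans (uP m) (le_trans _ Hb); rewrite lee_fin.
  by rewrite -(plateau_max H (leq_maxr m b)) plateau_homo // leq_maxl.
rewrite leqNgt; apply/negP => nb.
have := le_trans Hb (le_trans (nmax b) (uP n)).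
by rewrite lee_fin leNgt plateau_lt.
Qed.

(** * Realizability in terms of sets *)

Definition realizes (I : instance) (model : option nat) (s : side) (b : nat)
    (H : nat -> rat) : Prop :=
  (forall S : {set item I}, admissible model s S ->
     total_value S <= plateau b H #|S|) /\
  (forall n, (0 < n <= b)%N -> breakpoint b H n ->
     exists2 S : {set item I}, admissible model s S & #|S| = n /\ H n <= total_value S).

Lemma realizesP (I : instance) model s b H : target b H ->
  (is_terminal_count (U I model s) b /\ is_hull_sequence (U I model s) b H) <->
  realizes I model s b H.
Proof.
move=> tH; apply: iff_trans (terminal_hullP tH (U0 I model s)) _.
split=> [[uP Hu]|[leP exS]]; split.
- move=> S adm; rewrite -lee_fin; apply: le_trans (uP #|S|).
  by rewrite /U; apply: le_bigmax_cond; rewrite eqxx.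
- move=> n nb bp; have := Hu n nb bp.
  case: (pickP (fun S : {set item I} =>
    [&& #|S| == n, admissible model s S & H n <= total_value S])).
    by move=> S /and3P[/eqP Sn adm HS] _; exists S.
  move=> none; rewrite leNgt => /negP[]; apply/bigmax_ltP; split=> [|S /andP[Sn adm]].
    exact: ltNyr.
  by rewrite lte_fin ltNge; have := none S; rewrite /= Sn adm /= => ->.
- move=> n; apply/bigmax_leP; split=> [|S /andP[/eqP <- adm]]; first exact: leNye.
  by rewrite lee_fin leP.
- move=> n nb bp; have [S adm [Sn HS]] := exS n nb bp.
  apply: (@le_trans _ _ (total_value S)%:E); first by rewrite lee_fin.
  by rewrite /U; apply: le_bigmax_cond; rewrite Sn eqxx.
Qed.

Lemma realizableP model bw Hw br Hr : target bw Hw -> target br Hr ->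
  realizable model bw Hw br Hr <->
  exists I, realizes I model side_w bw Hw /\ realizes I model side_r br Hr.
Proof.
move=> tw tr; split=> [[I [Tw Pw Tr Pr]]|[I [/realizesP[]// Tw Pw /realizesP[]// Tr Pr]]].
  by exists I; split; apply/realizesP.
by exists I.
Qed.

Lemma realizes_count (I : instance) K s b H : realizes I (Some K) s b H ->
  (b <= count_bound K s)%N.
Proof.
case=> _ exS; have [->//|b0] := posnP b.
have [||S /andP[_ cS] [Sb _]] := exS b; rewrite ?b0 ?leqnn //.
  by rewrite /breakpoint eqxx.
by rewrite -Sb.
Qed.

Lemma realizes_cap (I : instance) K s b H : (b <= count_bound K s)%N ->
  realizes I None s b H -> realizes I (Some K) s b H.
Proof.
move=> bK [leS exS]; split=> [S /andP[wS _]|n nb bp].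
  by apply: leS; rewrite /admissible wS.
have [S /andP[wS _] [cS HS]] := exS n nb bp; exists S => //.
rewrite /admissible wS cS /= (leq_trans _ bK) //; by case/andP: nb.
Qed.

(** Since R < D, an r-admissible set is w-admissible. *)
Lemma terminal_count_w_gt0 (I : instance) bw Hw br Hr :
  target bw Hw -> target br Hr ->
  realizes I None side_w bw Hw -> realizes I None side_r br Hr ->
  (0 < br)%N -> (0 < bw)%N.
Proof.
move=> tw tr [leW _] [_ exR] br0; rewrite lt0n; apply/eqP => bw0.
have [||S /andP[wS _] [_ HS]] := exR br; rewrite ?br0 ?leqnn //.
  by rewrite /breakpoint eqxx.
have aS : admissible None side_w S.
  by rewrite /admissible /= (leq_trans wS) //= ltnW // capR_lt_capD.
have := lt_le_trans (target_gt0 tr br0) (le_trans HS (leW S aS)).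
by rewrite bw0 plateau_max //; case: tw => -> _ _; rewrite ltxx.
Qed.

Lemma leq_breakpoint_sum b H : (b <= breakpoint_sum b H)%N.
Proof.
case: b => // b; rewrite /breakpoint_sum big_mkcond big_nat_recr //=.
by rewrite /breakpoint eqxx leq_addl.
Qed.

(** * A small pool containing optimal sets *)

Lemma pooled_sets (T : finType) (P : nat -> pred {set T}) (r : seq nat) :
  (forall n, n \in r -> exists2 S : {set T}, P n S & #|S| = n) ->
  exists2 E : {set T}, (#|E| <= \sum_(n <- r) n)%N &
    forall n, n \in r -> exists2 S : {set T}, P n S & #|S| = n /\ S \subset E.
Proof.
elim: r => [|m r IH] ex; first by exists set0; rewrite ?cards0.
have [n nr|E cE exE] := IH; first by apply: ex; rewrite inE nr orbT.
have [A PA cA] := ex m (mem_head _ _).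
exists (A :|: E).
  by rewrite big_cons (leq_trans (leq_card_setU _ _)) // leq_add // cA.
move=> n; rewrite inE => /orP[/eqP->|/exE[S PS [cS SE]]].
  by exists A => //; rewrite subsetUl.
by exists S => //; rewrite cS (subset_trans SE) ?subsetUr.
Qed.

Lemma optimal_pool (I : instance) model s b H : realizes I model s b H ->
  exists2 E : {set item I}, (#|E| <= breakpoint_sum b H)%N &
    forall n, (0 < n <= b)%N -> breakpoint b H n ->
    exists2 S : {set item I}, admissible model s S &
      [/\ #|S| = n, H n <= total_value S & S \subset E].
Proof.
case=> _ exS; pose r := [seq n <- index_iota 1 b.+1 | breakpoint b H n].
have rP n : (n \in r) = breakpoint b H n && (0 < n <= b)%N.
  by rewrite mem_filter mem_index_iota ltnS.
have [n|E cE exE] := @pooled_sets _ (fun n (S : {set item I}) =>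
    admissible model s S && (H n <= total_value S)) r.
  by rewrite rP => /andP[bp nb]; have [S aS [cS HS]] := exS n nb bp; exists S; rewrite ?aS.
exists E; first by rewrite /breakpoint_sum -big_filter.
move=> n nb bp; have [|S /andP[aS HS] [cS SE]] := exE n; first by rewrite rP bp.
by exists S.
Qed.

Lemma total_valueS (I : instance) (A B : {set item I}) :
  A \subset B -> total_value A <= total_value B.
Proof.
move=> AB; rewrite /total_value (big_setID (A := B) A) /= (setIidPr AB) lerDl.
by apply: sumr_ge0 => i _; apply: value_ge0.
Qed.

Lemma total_weightS (I : instance) (A B : {set item I}) :
  A \subset B -> (total_weight A <= total_weight B)%N.
Proof.
by move=> AB; rewrite /total_weight (big_setID (A := B) A) /= (setIidPr AB) leq_addr.
Qed.

(** * Pruning an instance to a pool *)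

Lemma prune_value_ge0 (I : instance) (E : {set item I}) i :
  0 <= (if i \in E then value i else 0).
Proof. by case: ifP => // _; apply: value_ge0. Qed.

(** Deleting the items outside E, without changing the item type: a worthless
    item only increases the count and the weight of a set, and the plateau is
    nondecreasing in the count, so it can never help. *)
Definition prune (I : instance) (E : {set item I}) (R : nat)
    (hR : (R < capD I)%N) : instance :=
  Instance (prune_value_ge0 E) (@weight_gt0 I) hR (@weight_le_capD I).

Lemma prune_value (I : instance) (E : {set item I}) R (hR : (R < capD I)%N)
    (S : {set item I}) :
  total_value (I := prune E hR) S = total_value (I := I) (S :&: E).
Proof. by rewrite /total_value -big_mkcondr; apply: eq_bigl => i; rewrite inE. Qed.

(** Lifting the cap from a pruned instance leaves only subsets of E to check.
    The new capacity on side s must not be smaller than the old one unless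
    b = 0, when there is no witness to preserve. *)
Lemma realizes_prune (I : instance) (E : {set item I}) R (hR : (R < capD I)%N)
    model s b H :
  target b H ->
  (forall n, (0 < n <= b)%N -> breakpoint b H n ->
    exists2 S : {set item I}, admissible model s S &
      [/\ #|S| = n, H n <= total_value S & S \subset E]) ->
  ((0 < b)%N -> (capacity I s <= capacity (prune E hR) s)%N) ->
  (forall T : {set item I}, T \subset E ->
     (total_weight T <= capacity (prune E hR) s)%N ->
     total_value T <= plateau b H #|T|) ->
  realizes (prune E hR) None s b H.
Proof.
move=> tH exS capE leT; split=> [S|n nb bp].
  rewrite /admissible andbT => wS; rewrite prune_value.
  apply: le_trans (leT _ (subsetIr _ _) _) _.
    by apply: leq_trans wS; apply: (@total_weightS I); apply: subsetIl.
  by apply: plateau_homo => //; rewrite subset_leq_card // subsetIl.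
have [S /andP[wS _] [cS HS SE]] := exS n nb bp; exists S.
  rewrite /admissible andbT (leq_trans wS) // capE //.
  by case/andP: nb => n0 /(leq_trans n0).
by split=> //; rewrite prune_value (setIidPl SE).
Qed.

(** With K elements, E is the one subset of itself that the cap K excludes on
    the r side but not on the w side.  Its value is controlled through the w
    side: it is at most the value of A, so that either an item outside A can be
    discarded, or A = E and the r side is trivial. *)
Lemma full_pool_value (I : instance) K bw Hw br Hr (A E : {set item I}) :
  target bw Hw -> target br Hr -> (Nstar bw Hw br Hr <= K)%N -> (1 < K)%N ->
  realizes I (Some K) side_w bw Hw -> realizes I (Some K) side_r br Hr ->
  #|E| = K -> (total_weight E <= capR I)%N ->
  A \subset E -> #|A| = bw -> Hw bw <= total_value A ->
  total_value E <= plateau br Hr #|E|.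
Proof.
move=> tw tr NK K1 [leW _] [leR _] cE wE AE cA HA.
have EA : total_value E <= total_value A.
  apply: le_trans HA; apply: le_trans (leW E _) _.
    by rewrite /admissible /= cE leqnn (leq_trans wE) // ltnW // capR_lt_capD.
  by rewrite -(plateau_max Hw (leq_maxr #|E| bw)) plateau_homo // leq_maxl.
have [eAE|neAE] := eqVneq A E.
  (* bw = K already uses up the whole of N*. *)
  have br0 : br = 0%N.
    apply/eqP; rewrite -leqn0 -(leq_add2l K) addn0; apply: leq_trans NK.
    by rewrite /Nstar leq_add ?leq_breakpoint_sum // -cE -eAE cA leq_breakpoint_sum.
  rewrite br0 plateau_max //; case: (tr) => -> _ _.
  apply: sumr_le0 => x xE.
  have <- : total_value [set x] = value x by rewrite /total_value big_set1.
  apply: le_trans (leR [set x] _) _.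
    have -> : admissible (Some K) side_r [set x] =
        (total_weight [set x] <= capR I)%N.
      by rewrite /admissible /= cards1 ltn_predRL K1 andbT.
    by rewrite (leq_trans _ wE) // total_weightS // sub1set.
  by rewrite br0 plateau_max //; case: tr => ->.
have [x xE xA] : exists2 x, x \in E & x \notin A.
  by apply/subsetPn; apply: contraNN neAE => EsA; rewrite eqEsubset AE.
have ExE : E :\ x \subset E by apply: subD1set.
apply: le_trans EA (le_trans (total_valueS _) (le_trans (leR (E :\ x) _) _)).
- by rewrite subsetD1 AE.
- rewrite /admissible /= (leq_trans (total_weightS ExE)) //=.
  by rewrite -cE (cardsD1 x E) xE.
- by apply: plateau_homo => //; apply: subset_leq_card.
Qed.

(** * Changing the model *)

Lemma uncapped_realizable_at_cap bw Hw br Hr K :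
  target bw Hw -> target br Hr -> (maxn 1 (Nstar bw Hw br Hr) <= K)%N ->
  realizable_uncapped bw Hw br Hr -> realizable_at_cap K bw Hw br Hr.
Proof.
rewrite geq_max => tw tr /andP[K0 NK] /realizableP[]// I [rw rr].
have bK : (bw + br <= K)%N by apply: leq_trans NK; rewrite leq_add ?leq_breakpoint_sum.
apply/realizableP => //; exists I; split; apply: realizes_cap => //=.
  exact: leq_trans (leq_addr _ _) bK.
rewrite -ltnS prednK //; have [->//|br0] := posnP br.
apply: leq_trans bK; rewrite -add1n leq_add2r.
exact: terminal_count_w_gt0 tw tr rw rr br0.
Qed.

Lemma capped_realizable_uncapped bw Hw br Hr K :
  target bw Hw -> target br Hr -> (maxn 1 (Nstar bw Hw br Hr) <= K)%N ->
  realizable_at_cap K bw Hw br Hr -> realizable_uncapped bw Hw br Hr.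
Proof.
rewrite geq_max => tw tr /andP[K0 NK] /realizableP[]// I [rw rr].
have [Ew cEw exw] := optimal_pool rw; have [Er cEr exr] := optimal_pool rr.
pose E := Ew :|: Er.
have cE : (#|E| <= K)%N.
  by apply: leq_trans NK; rewrite (leq_trans (leq_card_setU _ _)) // leq_add.
pose R := if K == 1%N then 0%N else capR I.
have RI : (R <= capR I)%N by rewrite /R; case: ifP.
have hR : (R < capD I)%N by apply: leq_ltn_trans RI (capR_lt_capD I).
apply/realizableP => //; exists (prune E hR); split; apply: realizes_prune => //.
- move=> n nb bp; have [S aS [cS HS SE]] := exw n nb bp.
  by exists S; [exact: aS|split=> //; apply: subset_trans SE (subsetUl _ _)].
- move=> T TE wT; apply: (proj1 rw).
  by rewrite /admissible [X in X && _]wT (leq_trans (subset_leq_card TE)).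
- move=> n nb bp; have [S aS [cS HS SE]] := exr n nb bp.
  by exists S; [exact: aS|split=> //; apply: subset_trans SE (subsetUr _ _)].
(* R was lowered only if K = 1, and then the cap forces br = 0. *)
- have := realizes_count rr; rewrite /= /R; case: eqP => //= -> br0.
  by rewrite ltnNge br0.
move=> T TE wT; have wT' : (total_weight T <= capR I)%N by apply: leq_trans RI.
have [cT|] := leqP #|T| K.-1; first by apply: (proj1 rr); rewrite /admissible wT'.
rewrite prednK // => cT.
have eTE : T = E by apply/eqP; rewrite eqEcard TE (leq_trans cE).
have cEK : #|E| = K by apply/eqP; rewrite eqn_leq cE -eTE.
(* At K = 1 the capacity R is 0, so T would be empty, as weights are positive. *)
have K1 : (1 < K)%N.
  rewrite ltn_neqAle K0 andbT; apply: contraL cT => /eqP K1.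
  move: wT; rewrite /= /R -K1 eqxx leqn0 sum_nat_eq0 => /forall_inP w0.
  rewrite -leqNgt leqn0 cards_eq0; apply/eqP/setP => x; rewrite inE.
  by apply/negP => /w0; rewrite eqn0Ngt weight_gt0.
have [A [AE cA HA]] : exists A : {set item I},
    [/\ A \subset E, #|A| = bw & Hw bw <= total_value A].
  have [->|bw0] := posnP bw.
    exists set0; rewrite sub0set cards0 /total_value big_set0.
    by case: tw => ->.
  have [||S _ [cS HS SE]] := exw bw; rewrite ?bw0 ?leqnn //.
    by rewrite /breakpoint eqxx.
  by exists S; split=> //; apply: subset_trans SE (subsetUl _ _).
rewrite eTE; rewrite eTE in wT'.
exact: full_pool_value tw tr NK K1 rw rr cEK wT' AE cA HA.
Qed.

Theorem theorem5p6 (bw : nat) (Hw : nat -> rat) (br : nat) (Hr : nat -> rat)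
    (K : nat) (hw : target bw Hw) (hr : target br Hr)
    (hK : (maxn 1 (Nstar bw Hw br Hr) <= K)%N) :
  realizable_at_cap K bw Hw br Hr <-> realizable_uncapped bw Hw br Hr.
Proof.
split; first exact: capped_realizable_uncapped.
exact: uncapped_realizable_at_cap.
Qed.
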